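(* Let $G$ be a connected graph with minimum degree $\delta$ and maximum degree $\Delta$. Then $\mathrm{vp}^-(G) \geq \delta$ and $\mathrm{vp}(G) \geq \Delta$.
   Context: All graphs are finite, undirected and simple. A $u,v$-geodesic is a shortest $u,v$-path. For a vertex $x$ of $G$, a set $S \subseteq V(G)$ is an $x$-position set if for every $y \in S$ no vertex of $S \setminus \{y\}$ lies on any $x,y$-geodesic in $G$. The $x$-position number $p_x(G)$ is the maximum cardinality of an $x$-position set of $G$. Define $\mathrm{vp}(G) = \max_{x \in V(G)} p_x(G)$ and $\mathrm{vp}^-(G) = \min_{x \in V(G)} p_x(G)$. *)

(* Defs.v *)
From mathcomp Require Import all_boot.
From mathcomp Require Import boolp.

Set Implicit Arguments.
Unset Strict Implicit.
Unset Printing Implicit Defensive.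

(* A finite simple graph is a symmetric irreflexive adjacency relation [e] on
   a finType [V]. *)
Section Graph.
Variables (V : finType) (e : rel V).

Definition connected_graph : Prop :=
  0 < #|V| /\ forall x y : V, connect e x y.

Definition degree (x : V) : nat := #|[set y | e x y]|.

(* [p] lists the vertices after [u], so [u :: p] is the whole vertex sequence
   of the path and [size p] is its length. *)
Definition is_path (u v : V) (p : seq V) : Prop :=
  [/\ path e u p, last u p = v & uniq (u :: p)].

Definition geodesic (u v : V) (p : seq V) : Prop :=
  is_path u v p /\ forall q, is_path u v q -> size p <= size q.

Definition position_set (x : V) (S : {set V}) : Prop :=
  forall y, y \in S -> forall p, geodesic x y p ->
  forall z, z \in S :\ y -> z \notin x :: p.

Definition position_number (x : V) : nat :=
  \max_(S : {set V} | `[< position_set x S >]) #|S|.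

(* Both minima below are of functions bounded by [#|V|], so starting the
   iteration at [#|V|] does not change the minimum when [V] is nonempty. *)
Definition min_degree : nat := \big[minn/#|V|]_(x : V) degree x.
Definition max_degree : nat := \max_(x : V) degree x.

Definition vp : nat := \max_(x : V) position_number x.
Definition vp_minus : nat := \big[minn/#|V|]_(x : V) position_number x.

End Graph.

(* Main.v *)
Require Import Defs.
From mathcomp Require Import all_boot.
From mathcomp Require Import boolp.

(** The open neighbourhood of [x] is an [x]-position set: the only geodesic from
    [x] to a neighbour [y] is the edge [xy]. *)

(** Both bounds follow from the pointwise inequality [degree e x <= position_number e x], which
    holds because the neighbours of [x] form an [x]-position set; take the minimum and the maximum
    over [x]. *)

Lemma neighbourhood_position_set (V : finType) (e : rel V) (x : V) :
  irreflexive e -> position_set e x [set y | e x y].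
Proof.
move=> e_irr y; rewrite inE => exy p [[_ last_p _] p_min] z.
rewrite !inE => /andP[zNy exz].
have xNy : x != y by apply: contraTneq exy => ->; rewrite e_irr.
have zNx : z != x by apply: contraTneq exz => ->; rewrite e_irr.
have : size p <= size [:: y].
  by apply: p_min; split; rewrite //= ?exy // inE xNy.
(* An empty [p] would give [x = y], so [p] is [[:: y]], and [z] differs from both vertices. *)
case: p last_p {p_min} => [|a [|//]] /=; first by move/eqP: xNy.
by move=> -> _; rewrite inE negb_or zNx.
Qed.

Lemma degree_le_position_number (V : finType) (e : rel V) (x : V) :
  irreflexive e -> degree e x <= position_number e x.
Proof.
move=> e_irr; apply: (@leq_bigmax_cond _ _ (fun S : {set V} => #|S|)).
by apply/asboolP/neighbourhood_position_set.
Qed.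

Theorem lemma2p5 (V : finType) (e : rel V)
  (e_sym : symmetric e) (e_irr : irreflexive e)
  (e_conn : connected_graph e) :
  vp_minus e >= min_degree e /\ vp e >= max_degree e.
Proof.
split.
  (* Simultaneous induction on the two minima; both start at [#|V|], so the base case is trivial. *)
  rewrite /min_degree /vp_minus; elim/big_rec2: _ => // x m n _ le_mn.
  by rewrite leq_min !geq_min degree_le_position_number // le_mn orbT.
apply/bigmax_leqP => x _; apply: leq_trans (degree_le_position_number V e x e_irr) _.
exact: (leq_bigmax (F := position_number e)).
Qed.
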